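(* (Cutting off large densities for the fluid phase) Suppose that the zero range process starts from a sequence $\mu_0^N$, $N\in\mathbb N$, of distributions on $\mathbb M_N^d$ with finite first moments and with total mass $\mathfrak m>0$ in probability, and let $\{m_\ell\}_{\ell\ge1}\subset\mathbb Z_+$, $\{k_N^{(\ell)}\}_{N\ge1}\subset\mathbb N$, $\ell\in\mathbb N$, be diverging sequences such that $\mathbf Q^{k_N^{(\ell)},m_\ell}:=\boldsymbol\pi^{k_N^{(\ell)},m_\ell}_\sharp P^{k_N^{(\ell)}}$ converges weakly to some $\mathbf Q_*^{\infty,\infty}\in\mathcal P(L^\infty_{w^*}(0,T;\overline{\mathcal Y}_1(\mathbb T^d)))$ as $N\to\infty$ and then $\ell\to\infty$. Then for any $T>0$ $$\lim_{A\to+\infty}\ \sup_{M>0}\ \limsup_{\ell\to\infty}\limsup_{N\to\infty}\ \mathbb E^{k_N^{(\ell)}}\int_0^T\frac1{(k_N^{(\ell)})^d}\sum_{x\in\mathbb T^d_{k_N^{(\ell)}}}\big(\eta_t^{m_\ell}(x)\wedge M\big)\mathbf 1_{\{\eta_t^{m_\ell}(x)>A\}}\,dt=0 .$$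
   Context: **Zero range process (ZRP).** Fix $d\in\mathbb N$, $T>0$. $\mathbb T^d=\mathbb R^d/\mathbb Z^d$ with Lebesgue measure $\mathcal L_{\mathbb T^d}$; $\mathbb T^d_N=(\mathbb Z/N\mathbb Z)^d$; $\mathbb M_N^d=\mathbb Z_+^{\mathbb T_N^d}$. A local jump rate is $\mathfrak g:\mathbb Z_+\to\mathbb R_+$ with $\mathfrak g(k)=0\iff k=0$, $\sup_k|\mathfrak g(k+1)-\mathfrak g(k)|<\infty$, and such that $\varphi_c:=\lim_k (\mathfrak g(1)\cdots\mathfrak g(k))^{1/k}>0$ exists. The ZRP is the Markov jump process on $\mathbb M_N^d$ with generator $L^Nf(\eta)=N^2\sum_{x}\sum_{j=1}^d\sum_{e=\pm e_j}\mathfrak g(\eta(x))\{f(\eta^{x,x+e})-f(\eta)\}$, where $\eta^{x,y}$ is $\eta$ with one particle moved from $x$ to $y$. $P^N$ is its law on $D(0,T;\mathbb M_N^d)$ started from $\mu_0^N$, $\mathbb E^N$ the expectation. Total mass $\mathfrak m$ in probability means $\lim_N\mu_0^N\{|N^{-d}\sum_x\eta(x)-\mathfrak m|>\delta\}=0$ for all $\delta>0$. **Generalized Young functionals.** $\overline C_1(\mathbb T^d\times\mathbb R_+)$ is the Banach space of $F\in C(\mathbb T^d\times\mathbb R_+)$ such that $F(\cdot,\lambda)/(1+\lambda)$ converges uniformly on $\mathbb T^d$ as $\lambda\to\infty$, to a limit denoted $RF\in C(\mathbb T^d)$, with norm $\sup|F(u,\lambda)|/(1+\lambda)$; $\overline{\mathcal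 M}_1$ is its dual. Every $\boldsymbol\pi\in\overline{\mathcal M}_1$ is represented by a unique pair $(\boldsymbol\rho_{\boldsymbol\pi},\rho^\perp_{\boldsymbol\pi})$, $\boldsymbol\rho_{\boldsymbol\pi}$ a signed Borel measure on $\mathbb T^d\times\mathbb R_+$ with $\int(1+\lambda)d|\boldsymbol\rho_{\boldsymbol\pi}|<\infty$ and $\rho^\perp_{\boldsymbol\pi}$ a signed Borel measure on $\mathbb T^d$, via $\boldsymbol\pi(F)=\int F\,d\boldsymbol\rho_{\boldsymbol\pi}+\int RF\,d\rho^\perp_{\boldsymbol\pi}$. $\overline{\mathcal Y}_1(\mathbb T^d)$ is the set of non-negative $\boldsymbol\pi$ for which $\boldsymbol\rho_{\boldsymbol\pi}$ is a probability measure with first marginal $\mathcal L_{\mathbb T^d}$. **Path space and process.** $L^\infty_{w^*}(0,T;\overline{\mathcal M}_1)$ is the space of a.e.-classes of $w^*$-measurable, essentially bounded maps $[0,T]\to\overline{\mathcal M}_1$, the dual of the Bochner space $L^1(0,T;\overline C_1(\mathbb T^d\times\mathbb R_+))$ under $\langle\!\langle F,\boldsymbol\pi\rangle\!\rangle=\int_0^T\langle F_t,\boldsymbol\pi_t\rangle dt$, with the $w^*$-topology and its Borel $\sigma$-algebra; $L^\infty_{w^*}(0,T;K)$ denotes the paths with values in $K$ a.e. Probability measures carry the weak topology. $\langle\!\langle F,\boldsymbol\pi^{N,\ell}\rangle\!\rangle=\int_0^TN^{-d}\sum_xF_t(x/N,\eta^\ell_t(x))dt$, $\eta^\ell(x)=(2\ell+1)^{-d}\sum_{|y|\le\ell}\eta(x+y)$,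 $|\cdot|$ the sup norm. *)

(* Defs.v *)
From HB Require Import structures.
From mathcomp Require Import all_boot all_order all_algebra.
From mathcomp Require Import all_classical all_reals all_analysis.
From mathcomp Require Import finmap.
Import Order.TTheory GRing.Theory Num.Theory.
Import numFieldNormedType.Exports.

Set Implicit Arguments.
Unset Strict Implicit.
Unset Printing Implicit Defensive.

Local Open Scope classical_set_scope.
Local Open Scope ring_scope.
Local Open Scope quotient_scope.

Section torus.
Variables (R : realType) (d : nat).

Definition torus_rel (u v : 'rV[R]_d) : bool :=
  [forall i, (u ord0 i - v ord0 i) \is a Num.int].

Lemma torus_rel_refl : reflexive torus_rel.
Proof. by move=> u; apply/forallP => i; rewrite subrr int_num0. Qed.

Lemma torus_rel_sym : symmetric torus_rel.
Proof.
by move=> u v; apply/eq_forallb => i; rewrite -opprB rpredN.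
Qed.

Lemma torus_rel_trans : transitive torus_rel.
Proof.
move=> v u w /forallP uv /forallP vw; apply/forallP => i.
by rewrite -(subrKA (v ord0 i)) rpredD.
Qed.

Definition torus_equiv :=
  EquivRel torus_rel torus_rel_refl torus_rel_sym torus_rel_trans.

Definition torus := {eq_quot torus_equiv}.

HB.instance Definition _ := Topological.copy torus (quotient_topology torus).
HB.instance Definition _ := isPointed.Build torus (\pi_torus (0 : 'rV[R]_d)).
HB.instance Definition _ := Quotient.on torus.

Definition proj_torus (v : 'rV[R]_d) : torus := (\pi_torus v).

Lemma proj_torus_continuous : continuous proj_torus.
Proof. exact: pi_continuous. Qed.

Lemma torus_compact : compact [set: torus].
Proof.
pose D := [set v : 'rV[R]_d | forall i, `[0, 1]%classic (v ord0 i)].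
have cD : compact D.
  apply: (@rV_compact R d (fun=> `[0, 1]%classic)) => _.
  exact: segment_compact.
suff <- : proj_torus @` D = [set: torus].
  by apply: continuous_compact cD; apply: continuous_subspaceT;
     exact: proj_torus_continuous.
apply/seteqP; split => // x _.
pose v := repr x.
exists (\row_i (v ord0 i - (Num.floor (v ord0 i))%:~R)).
  move=> i /=; rewrite !mxE in_itv /=; apply/andP; split.
    by rewrite subr_ge0 floor_le.
  by rewrite lerBlDl -intrD1 ltW// floorD1_gt.
rewrite /proj_torus -[RHS]reprK; apply/eqmodP/forallP => i.
by rewrite !mxE addrAC subrr add0r rpredN intr_int.
Qed.

End torus.

Section halfline.
Variable R : realType.

Definition halfline := {x : R | 0 <= x}.

HB.instance Definition _ := SubChoice.on halfline.
HB.instance Definition _ :=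
  Topological.copy halfline (initial_topology (\val : halfline -> R)).

Lemma halfline_ge0 (l : halfline) : 0 <= \val l.
Proof. exact: valP. Qed.

Lemma halfline_subproof (x : R) : 0 <= Num.max 0 x.
Proof. by rewrite le_max lexx. Qed.

Definition to_halfline (x : R) : halfline := Sub (Num.max 0 x) (halfline_subproof x).

HB.instance Definition _ := isPointed.Build halfline (to_halfline 0).

Lemma to_halfline_continuous : continuous to_halfline.
Proof.
apply/continuousP => _ [A oA <-]; rewrite -comp_preimage.
have : continuous (Num.max 0 : R -> R).
  by move=> x; apply: continuous_max; [exact: cvg_cst|exact: cvg_id].
by move/continuousP; apply.
Qed.

Lemma halfline_compact (K : R) : compact [set l : halfline | \val l <= K].
Proof.
have -> : [set l : halfline | \val l <= K] = to_halfline @` `[0, K].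
  apply/seteqP; split => [l /= lK|_ [x /= + <-]].
    exists (\val l); first by rewrite /= in_itv /= halfline_ge0.
    by apply: val_inj; rewrite /= max_r// halfline_ge0.
  by rewrite in_itv /= => /andP[x0 xK]; rewrite max_r.
apply: continuous_compact; last exact: segment_compact.
by apply: continuous_subspaceT; exact: to_halfline_continuous.
Qed.

End halfline.

Section C1.
Variables (R : realType) (d : nat).
Local Notation X := (torus R d * halfline R)%type.

(* [F(., l) / (1 + l)] converges to [r] uniformly on the torus as [l] tends to
   infinity. *)
Definition recession_limit (F : X -> R) (r : torus R d -> R) :=
  continuous r /\
  forall e : R, 0 < e -> exists K : R, forall (u : torus R d) (l : halfline R),
    K <= \val l -> `|F (u, l) / (1 + \val l) - r u| <= e.

Definition C1_pred : {pred X -> R^o} :=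
  mem [set F : X -> R^o | continuous F /\ exists r, recession_limit F r].

Lemma recession_limitD F G r s : recession_limit F r -> recession_limit G s ->
  recession_limit (F \+ G) (r \+ s).
Proof.
move=> [cr Fr] [cs Gs]; split.
  by move=> x; apply: (@cvgD _ R _ (nbhs x) _ r s); [exact: cr|exact: cs].
move=> e e0; have e20 : 0 < e / 2 by rewrite divr_gt0.
have [K1 H1] := Fr _ e20; have [K2 H2] := Gs _ e20.
exists (Num.max K1 K2) => u l; rewrite ge_max => /andP[l1 l2].
rewrite /= mulrDl opprD addrACA (splitr e) (le_trans (ler_normD _ _))//.
by apply: lerD; [exact: H1|exact: H2].
Qed.

Lemma recession_limitZ (a : R) F r : recession_limit F r ->
  recession_limit (fun p => a * F p) (fun u => a * r u).
Proof.
move=> [cr Fr]; split.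
  by move=> x; apply: (@cvgM _ _ (nbhs x) _ (fun=> a) r a (r x)); [exact: cvg_cst|exact: cr].
move=> e e0; have a0 : 0 < `|a| + 1 by rewrite ltr_wpDl.
have [K H] := Fr _ (divr_gt0 e0 a0); exists K => u l lK; have {lK}H := H u l lK.
rewrite -mulrA -mulrBr normrM.
rewrite (le_trans (ler_wpM2l _ H))// mulrA ler_pdivrMr// mulrC.
by rewrite ler_pM2l// lerDl.
Qed.

Lemma C1_submod : submod_closed C1_pred.
Proof.
split.
  apply/mem_set; split; first by move=> ?; exact: cvg_cst.
  exists (fun=> 0); split=> [?|e e0]; first exact: cst_continuous.
  by exists 0 => u l _; rewrite mul0r subrr normr0 ltW.
move=> a F G /set_mem[cF [r Fr]] /set_mem[cG [s Gs]]; apply/mem_set; split.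
  move=> x; apply: (@cvgD _ R _ (nbhs x) _ (fun p => a * F p) G); last exact: cG.
  by apply: (@cvgM _ _ (nbhs x) _ (fun=> a) F a (F x)); [exact: cvg_cst|exact: cF].
exists ((fun u => a * r u) \+ s); apply: recession_limitD Gs.
exact: recession_limitZ.
Qed.

HB.instance Definition _ := GRing.isSubmodClosed.Build R (X -> R^o) C1_pred C1_submod.

Record C1 := MkC1 { C1_fun :> X -> R^o ; C1_funP : C1_fun \in C1_pred }.

HB.instance Definition _ := [isSub for C1_fun].
HB.instance Definition _ := [Choice of C1 by <:].
HB.instance Definition _ := [SubChoice_isSubLmodule of C1 by <:].

Lemma C1_bounded (F : C1) :
  exists B : R, forall p : X, `|F p| / (1 + \val p.2) <= B.
Proof.
have /set_mem[/= cF [r [cr Fr]]] := C1_funP F.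
have [K HK] := Fr _ ltr01.
have /compact_bounded[M1 [_ HM1]] : compact (r @` [set: torus R d]).
  apply: continuous_compact; last exact: torus_compact.
  exact: continuous_subspaceT.
have /compact_bounded[M2 [_ HM2]] :
    compact (F @` ([set: torus R d] `*` [set l : halfline R | \val l <= K])).
  apply: continuous_compact.
    exact: continuous_subspaceT.
  by apply: compact_setX; [exact: torus_compact|exact: halfline_compact].
have {}HM1 u : `|r u| <= `|M1| + 1.
  by apply: (HM1 (`|M1| + 1)); [rewrite (le_lt_trans (ler_norm _))// ltrDl|exists u].
have {}HM2 p : \val p.2 <= K -> `|F p| <= `|M2| + 1.
  move=> pK; apply: (HM2 (`|M2| + 1)); first by rewrite (le_lt_trans (ler_norm _))// ltrDl.
  by exists p.
exists (`|M1| + 1 + 1 + (`|M2| + 1)) => -[u l] /=.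
have l1 : 1 <= 1 + \val l by rewrite lerDl halfline_ge0.
have l0 : 0 < 1 + \val l by rewrite (lt_le_trans ltr01).
have [lK|/ltW Kl] := leP (\val l) K.
  rewrite ler_wpDl// ler_pdivrMr// (le_trans (HM2 (u, l) lK))//.
  by rewrite ler_peMr.
rewrite ler_wpDr//.
have -> : `|F (u, l)| / (1 + \val l) = `|F (u, l) / (1 + \val l)|.
  by rewrite normf_div (gtr0_norm l0).
have -> : F (u, l) / (1 + \val l) = (F (u, l) / (1 + \val l) - r u) + r u.
  by rewrite subrK.
by rewrite (le_trans (ler_normD _ _))// addrC lerD// HK.
Qed.

Definition C1_norm (F : C1) : R :=
  sup [set `|F p| / (1 + \val p.2) | p in [set: X]].

Lemma C1_norm_has_sup (F : C1) :
  has_sup [set `|F p| / (1 + \val p.2) | p in [set: X]].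
Proof.
split; first by exists (`|F point| / (1 + \val (point : X).2)); exists point.
by have [B HB] := C1_bounded F; exists B => _ [p _ <-].
Qed.

Lemma C1_weight_gt0 (l : halfline R) : 0 < 1 + \val l.
Proof. by rewrite ltr_pwDl// halfline_ge0. Qed.

Lemma le_C1_norm (F : C1) (p : X) : `|F p| <= C1_norm F * (1 + \val p.2).
Proof.
rewrite -ler_pdivrMr ?C1_weight_gt0//.
by apply: (ub_le_sup (C1_norm_has_sup F).2); exists p.
Qed.

Lemma C1_norm_le (F : C1) (B : R) :
  (forall p, `|F p| <= B * (1 + \val p.2)) -> C1_norm F <= B.
Proof.
move=> FB; apply: (ge_sup (C1_norm_has_sup F).1) => _ [p _ <-].
by rewrite ler_pdivrMr ?C1_weight_gt0.
Qed.

Lemma C1_normD F G : C1_norm (F + G) <= C1_norm F + C1_norm G.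
Proof.
apply: C1_norm_le => p; rewrite mulrDl.
by rewrite (le_trans (ler_normD _ _))// lerD// le_C1_norm.
Qed.

Lemma C1_norm_ge0 F : 0 <= C1_norm F.
Proof.
have := le_trans (normr_ge0 _) (le_C1_norm F point).
by rewrite pmulr_lge0// C1_weight_gt0.
Qed.

Lemma C1_normZ_le (a : R) F : C1_norm (a *: F) <= `|a| * C1_norm F.
Proof.
apply: C1_norm_le => p; rewrite -mulrA.
rewrite [leLHS](_ : _ = `|a| * `|F p|); last by rewrite -normrM.
by rewrite ler_wpM2l// le_C1_norm.
Qed.

Lemma C1_normZ (a : R) F : C1_norm (a *: F) = `|a| * C1_norm F.
Proof.
apply/eqP; rewrite eq_le C1_normZ_le /=.
have [->|a0] := eqVneq a 0; first by rewrite normr0 mul0r C1_norm_ge0.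
rewrite -ler_pdivlMl ?normr_gt0// -normfV.
by rewrite (le_trans _ (C1_normZ_le _ _))// scalerA mulVf// scale1r.
Qed.

Lemma C1_norm_eq0 F : C1_norm F = 0 -> F = 0.
Proof.
move=> F0; apply: val_inj; apply/funext => p; apply/eqP.
by rewrite -normr_le0 (le_trans (le_C1_norm F p))// F0 mul0r.
Qed.

HB.instance Definition _ := Lmodule_isNormed.Build R C1
  C1_normD C1_normZ C1_norm_eq0.

End C1.

Section M1.
Variables (R : realType) (d : nat).
Local Notation X := (torus R d * halfline R)%type.
Local Notation C1 := (C1 R d).

(* [RF]; the limit exists and is unique for every [F : C1]. *)
Definition recession (F : C1) : torus R d -> R := get (recession_limit F).

Record M1 := MkM1 {
  M1_lin :> {linear C1 -> R^o} ;
  M1_continuous : continuous M1_lin }.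

Definition M1_zero : M1 :=
  @MkM1 (\0 : {linear C1 -> R^o}) (@cst_continuous C1 R^o 0).

HB.instance Definition _ := gen_eqMixin M1.
HB.instance Definition _ := gen_choiceMixin M1.
HB.instance Definition _ := isPointed.Build M1 M1_zero.

Definition borel_torus := g_sigma_algebraType (@open (torus R d)).
Definition borel_state := g_sigma_algebraType (@open X).

(* Lebesgue measure on the torus, through its values on the boxes of the
   fundamental cell, which determine it among the Borel measures. *)
Definition is_torus_lebesgue (mu : set borel_torus -> \bar R) :=
  forall a b : 'rV[R]_d,
    (forall i, 0 <= a ord0 i <= b ord0 i /\ b ord0 i <= 1) ->
    mu (@proj_torus R d @`
      [set v : 'rV[R]_d | forall i, a ord0 i <= v ord0 i < b ord0 i]) =
    (\prod_i (b ord0 i - a ord0 i))%:E.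

(* Representation of [pi] by the pair [(rho, sp - sn)]; the signed measure on
   the torus is given as a difference of two finite measures. *)
Definition represents (pi : M1) (rho : {measure set borel_state -> \bar R})
    (sp sn : {finite_measure set borel_torus -> \bar R}) :=
  (\int[rho]_p (1 + \val p.2)%:E < +oo)%E /\
  forall F : C1, pi F = \int[rho]_(p in setT) F p +
    (\int[sp]_(u in setT) recession F u - \int[sn]_(u in setT) recession F u).

Definition Y1 (pi : M1) :=
  (forall F : C1, (forall p, 0 <= F p) -> 0 <= pi F) /\
  exists (rho : probability borel_state R)
    (sp sn : {finite_measure set borel_torus -> \bar R}),
    represents pi rho sp sn /\
    is_torus_lebesgue (pushforward rho (fst : borel_state -> borel_torus)).

End M1.

Section path_space.
Variables (R : realType) (d : nat) (T : R).
Local Notation C1 := (C1 R d).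
Local Notation M1 := (M1 R d).
Local Notation mu := (@lebesgue_measure R).

Record wpath := MkWpath {
  wpath_fun :> R -> M1 ;
  wpath_measurable : forall F : C1,
    measurable_fun `[0, T] (fun t => wpath_fun t F : R) ;
  wpath_bounded : exists B : R,
    {ae mu, forall t, 0 <= t <= T ->
      forall F : C1, `|wpath_fun t F| <= B * `|F|} }.

HB.instance Definition _ := gen_eqMixin wpath.
HB.instance Definition _ := gen_choiceMixin wpath.

Definition wpath_rel (p q : wpath) : bool := `[< p = q %[ae mu in `[0, T]%classic] >].

Lemma wpath_rel_refl : reflexive wpath_rel.
Proof. by move=> p; apply/asboolP; apply: ae_eq_refl. Qed.

Lemma wpath_rel_sym : symmetric wpath_rel.
Proof.
by move=> p q; apply/idP/idP => /asboolP pq; apply/asboolP; apply: ae_eq_sym.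
Qed.

Lemma wpath_rel_trans : transitive wpath_rel.
Proof.
by move=> q p r /asboolP pq /asboolP qr; apply/asboolP; apply: ae_eq_trans pq qr.
Qed.

Definition wpath_equiv :=
  EquivRel wpath_rel wpath_rel_refl wpath_rel_sym wpath_rel_trans.

(* a.e.-classes on [0, T] *)
Definition Linfty := {eq_quot wpath_equiv}.
HB.instance Definition _ := Choice.on Linfty.
HB.instance Definition _ := EqQuotient.on Linfty.

Definition simple_C1 (s : R -> C1) :=
  finite_set (s @` `[0, T]) /\
  forall c : C1, measurable (`[0, T] `&` s @^-1` [set c]).

Definition bochner_integrable (F : R -> C1) :=
  (exists s : nat -> R -> C1, (forall n, simple_C1 (s n)) /\
    forall t, 0 <= t <= T -> s n t @[n --> \oo] --> F t) /\
  (\int[mu]_(t in `[0%R, T]) (`|F t|%R)%:E < +oo)%E.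

(* Functions rather than a.e.-classes: these only serve as test functions in
   [pairing]. Asking for pointwise rather than a.e. convergence of the simple
   functions selects a representative in each class. *)
Definition L1_C1 := {F : R -> C1 | bochner_integrable F}.

Definition pairing (F : L1_C1) (p : Linfty) : R :=
  \int[mu]_(t in `[0, T]) (repr p : wpath) t (sval F t).

(* The w*-topology *)
HB.instance Definition _ := Topological.copy Linfty
  (initial_topology
    ((fun p F => pairing F p) : Linfty -> {ptws L1_C1 -> R})).

Lemma wpath0_measurable (F : C1) :
  measurable_fun `[0, T] (fun=> (M1_zero R d) F : R).
Proof. exact: measurable_cst. Qed.

Lemma wpath0_bounded : exists B : R,
  {ae mu, forall t, 0 <= t <= T ->
    forall F : C1, `|(M1_zero R d) F| <= B * `|F|}.
Proof. by exists 0; apply: aeW => t _ F; rewrite mul0r normr0. Qed.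

Definition wpath0 := MkWpath wpath0_measurable wpath0_bounded.

HB.instance Definition _ := isPointed.Build Linfty (\pi_Linfty wpath0).

Definition borel_Linfty := g_sigma_algebraType (@open Linfty).

Definition Linfty_Y1 (p : Linfty) :=
  {ae mu, forall t, 0 <= t <= T -> Y1 ((repr p : wpath) t)}.

Definition weak_cvg (Q_ : nat -> probability borel_Linfty R)
    (Q : probability borel_Linfty R) :=
  forall Phi : Linfty -> R, continuous Phi ->
    (exists B : R, forall p, `|Phi p| <= B) ->
    \int[Q_ n]_(p in setT) Phi p @[n --> \oo] --> \int[Q]_(p in setT) Phi p.

End path_space.

Section zero_range.
Variables (R : realType) (d : nat).

(* For [N > 0], [N.-1.+1] is [N] and ['I_N.-1.+1] is the group Z/NZ. *)
Definition site (N : nat) := {ffun 'I_d -> 'I_N.-1.+1}.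

Definition config (N : nat) := {ffun site N -> nat}.

HB.instance Definition _ N := Choice.on (config N).
HB.instance Definition _ N := isPointed.Build (config N) [ffun=> 0%N].
HB.instance Definition _ N := @isMeasurable.Build default_measure_display
  (config N) discrete_measurable discrete_measurable0
  discrete_measurableC discrete_measurableU.

Variable N : nat.
Implicit Types (eta : config N) (x y : site N).

Definition unit_site (j : 'I_d) : site N := [ffun i => inZp (i == j)].

Definition jump eta x y : config N :=
  [ffun z => (eta z - (z == x) + (z == y))%N].

Definition generator (g : nat -> R) (f : config N -> R) eta : R :=
  N%:R ^+ 2 * \sum_x \sum_(j < d)
    (g (eta x) * (f (jump eta x (x + unit_site j)) - f eta) +
     g (eta x) * (f (jump eta x (x - unit_site j)) - f eta)).

Definition num_particles eta : nat := (\sum_x eta x)%N.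

(* [y] ranges over {0, ..., 2l}^d, so that [y - l] ranges over the integer
   points of sup norm at most [l]. *)
Definition block_avg (l : nat) eta x : R :=
  ((2 * l + 1)%N%:R ^+ d)^-1 *
  \sum_(y : {ffun 'I_d -> 'I_(2 * l + 1)})
    (eta (x + [ffun i => inZp (y i)] - [ffun=> inZp l]))%:R.

Lemma block_avg_ge0 l eta x : 0 <= block_avg l eta x.
Proof.
by rewrite mulr_ge0 ?invr_ge0 ?exprn_ge0 ?ler0n//; apply: sumr_ge0 => y _.
Qed.

Definition truncated_excess (l : nat) (A M : R) eta : R :=
  (N%:R ^+ d)^-1 * \sum_x
    Num.min (block_avg l eta x) M * (A < block_avg l eta x)%R%:R.

(* x / N *)
Definition macro x : torus R d := proj_torus (\row_i ((x i : nat)%:R / N%:R)).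

Section path.
Variable T : R.

(* Cadlag for the discrete topology. Values outside [0, T] are unconstrained,
   and invisible to the sigma-algebra below. *)
Definition cadlag (w : R -> config N) :=
  (forall t, 0 <= t < T -> \forall s \near t^'+, w s = w t) /\
  (forall t, 0 < t <= T -> exists z, \forall s \near t^'-, w s = z).

Record skorokhod := MkSkorokhod { sk_fun :> R -> config N ; sk_cadlag : cadlag sk_fun }.

Lemma cadlag_cst z : cadlag (fun=> z).
Proof. by split=> [t _|t _]; [|exists z]; apply: nearW. Qed.

HB.instance Definition _ := gen_eqMixin skorokhod.
HB.instance Definition _ := gen_choiceMixin skorokhod.
HB.instance Definition _ := isPointed.Build skorokhod
  (MkSkorokhod (cadlag_cst [ffun=> 0%N])).

Definition cylinders : set (set skorokhod) :=
  [set A | exists t z, 0 <= t <= T /\ A = [set w : skorokhod | w t = z]].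

Definition pathD := g_sigma_algebraType cylinders.

(* A Markov semigroup, given by the kernels [p t], whose generator is that of
   the zero range process; [p t] is irrelevant for [t < 0]. *)
Record is_semigroup (g : nat -> R) (p : R -> config N -> probability (config N) R) := {
  semigroup0 : forall eta A, p 0 eta A = \d_eta A ;
  semigroupD : forall s t eta A, 0 <= s -> 0 <= t ->
    p (s + t) eta A = (\int[p s eta]_zeta p t zeta A)%E ;
  semigroup_generator : forall (f : config N -> R) eta,
    (exists B : R, forall z, `|f z| <= B) ->
    h^-1 * (\int[p h eta]_(z in setT) f z - f eta) @[h --> 0^'+] -->
    generator g f eta }.

(* [P] is the law of the Markov jump process with initial law [mu0] and with
   the above generator: finite-dimensional distributions. *)
Definition is_zrp (g : nat -> R) (mu0 : probability (config N) R)
    (P : probability pathD R) :=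
  exists2 p, is_semigroup g p &
  forall (n : nat) (t : nat -> R) (z : nat -> config N),
    t 0%N = 0 -> (forall i, (i < n)%N -> t i <= t i.+1) -> t n <= T ->
    P [set w : skorokhod | forall i, (i <= n)%N -> w (t i) = z i] =
    (mu0 [set z 0%N] * \prod_(i < n) p (t i.+1 - t i)%R (z i) [set z i.+1])%E.

End path.

Section empirical.
Variable l : nat.

Definition emp_fun eta (F : C1 R d) : R^o :=
  (N%:R ^+ d)^-1 * \sum_x F (macro x, to_halfline (block_avg l eta x)).

Lemma emp_fun_linear eta : linear (emp_fun eta).
Proof.
move=> a F G; rewrite /emp_fun.
rewrite [RHS](_ : _ = a * ((N%:R ^+ d)^-1 * \sum_x
    F (macro x, to_halfline (block_avg l eta x))) + (N%:R ^+ d)^-1 * \sum_x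
    G (macro x, to_halfline (block_avg l eta x)))//.
rewrite [a * _]mulrCA -mulrDr; congr (_ * _).
by rewrite [a * _]mulr_sumr -big_split.
Qed.

HB.instance Definition _ eta :=
  GRing.isLinear.Build R (C1 R d) R^o *:%R (emp_fun eta) (emp_fun_linear eta).

Definition emp_bound eta : R :=
  (N%:R ^+ d)^-1 * \sum_x (1 + block_avg l eta x).

Lemma emp_fun_bounded eta F : `|emp_fun eta F| <= emp_bound eta * `|F|.
Proof.
have N0 : 0 <= (N%:R ^+ d : R)^-1 by rewrite invr_ge0 exprn_ge0.
rewrite normrM ger0_norm// -mulrA ler_wpM2l// mulr_suml.
rewrite (le_trans (ler_norm_sum _ _ _))//; apply: ler_sum => x _.
by rewrite mulrC (le_trans (le_C1_norm _ _))//= max_r// block_avg_ge0.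
Qed.

Lemma emp_continuous eta : continuous (emp_fun eta).
Proof.
apply: bounded_linear_continuous; apply/linear_boundedP.
exists (emp_bound eta); split; first exact: num_real.
move=> r /ltW br F.
by rewrite (le_trans (emp_fun_bounded _ _))// ler_wpM2r.
Qed.

Definition emp eta : M1 R d := MkM1 (@emp_continuous eta).

End empirical.

End zero_range.

Section cadlag_theory.
Variables (R : realType) (d N : nat) (T : R).
Variable w : skorokhod d N T.

Let good (B : set R) :=
  finite_set (w @` (B `&` `[0, T])) /\
  forall z, measurable (B `&` `[0, T] `&` w @^-1` [set z]).

Lemma cadlag_right t : 0 <= t <= T ->
  exists2 e, 0 < e & forall s, t <= s < t + e -> s <= T -> w s = w t.
Proof.
move=> /andP[t0]; rewrite le_eqVlt => /predU1P[->|tT].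
  by exists 1 => // s /andP[Ts _] sT; congr (w _); apply/eqP; rewrite eq_le sT.
have [+ _] := sk_cadlag w; move=> /(_ t); rewrite t0 => /(_ tT).
move=> /nbhs_ballP[e /= e0 He]; exists e => // s /andP[].
rewrite le_eqVlt => /predU1P[<- //|ts] ste _.
by apply: He => //=; rewrite /ball/= distrC gtr0_norm ?subr_gt0// ltrBlDl.
Qed.

Lemma cadlag_left t : 0 <= t <= T ->
  exists z, exists2 e, 0 < e & forall s, t - e < s < t -> 0 <= s -> w s = z.
Proof.
move=> /andP[+ tT]; rewrite le_eqVlt => /predU1P[<-|t0].
  by exists (w 0), 1 => // s /andP[_ s0] s1; have := lt_le_trans s0 s1; rewrite ltxx.
have [_ +] := sk_cadlag w; move=> /(_ t); rewrite t0 => /(_ tT)[z].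
move=> /nbhs_ballP[e /= e0 He]; exists z, e => // s /andP[tes st] _.
by apply: He => //=; rewrite /ball/= gtr0_norm ?subr_gt0// ltrBlDr -ltrBlDl.
Qed.

Lemma good_local t : 0 <= t <= T -> exists2 e, 0 < e & good `]t - e, t + e[.
Proof.
move=> tT; have [e e0 He] := cadlag_right tT.
have [z0 [e' e'0 He']] := cadlag_left tT.
have em0 : 0 < Num.min e e' by rewrite lt_min e0.
exists (Num.min e e') => //.
have wE s : s \in `]t - Num.min e e', t + Num.min e e'[ -> 0 <= s <= T ->
    w s = if s < t then z0 else w t.
  rewrite in_itv/= => /andP[h1 h2] /andP[s0 sT]; case: ifPn => [st|].
    apply: He' => //; rewrite st andbT (le_lt_trans _ h1)// lerB//.
    by rewrite ge_min lexx orbT.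
  rewrite -leNgt => tls; apply: He => //; rewrite tls (lt_le_trans h2)// lerD2l.
  by rewrite ge_min lexx.
split.
  apply: (sub_finite_set (B := [set z0; w t])); last exact: finite_set2.
  move=> _ [s [/= h +] <-]; rewrite in_itv/= => sT; rewrite wE//.
  by case: ifP => _; [left|right].
move=> z; set B := (X in [set` X] `&` _ `&` _).
have -> : [set` B] `&` `[0, T] `&` w @^-1` [set z] =
    [set` B] `&` `[0, T] `&` ((`]-oo, t[ `&` [set _ | z0 = z]) `|`
                            (`[t, +oo[ `&` [set _ | w t = z])).
  apply/seteqP; split=> s [[/= Bs]]; rewrite in_itv/= => sT.
    rewrite wE// => h; split; first by split=> //=; rewrite in_itv.
    by move: h; case: ltP => st h; [left|right]; split => //=; rewrite in_itv/= ?andbT.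
  move=> h; split; first by split=> //=; rewrite in_itv.
  rewrite /= wE//; case: h => -[/=]; rewrite in_itv/= ?andbT.
    by move=> ->.
  by move=> /le_gtF ->.
apply: measurableI; first exact: measurableI.
apply: measurableU; apply: measurableI => //.
  by have [zz|zz] := pselect (z0 = z);
    [rewrite (_ : mkset _ = setT)|rewrite (_ : mkset _ = set0)] => //;
    apply/seteqP; split.
by have [zz|zz] := pselect (w t = z);
    [rewrite (_ : mkset _ = setT)|rewrite (_ : mkset _ = set0)] => //;
    apply/seteqP; split.
Qed.

Lemma good_itv : good `[0, T].
Proof.
have ex_e t : exists e, 0 <= t <= T -> 0 < e /\ good `]t - e, t + e[.
  have [tT|] := boolP (0 <= t <= T); last by exists 0.
  by have [e e0 ge] := good_local tT; exists e.
pose e t := sval (cid (ex_e t)).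
have He t : 0 <= t <= T -> 0 < e t /\ good `]t - e t, t + e t[.
  exact: (svalP (cid (ex_e t))).
have := @segment_compact R 0 T.
rewrite compact_cover => /(_ R `[0, T]%classic (fun t => `]t - e t, t + e t[%classic)).
case.
- by move=> t _; exact: interval_open.
- move=> t tT; exists t => //=; move: tT; rewrite /= !in_itv/= => /He[e0 _].
  by rewrite ltrBlDr !ltrDl e0.
move=> D' D'T cov.
have covE B : `[0, T] `&` `[0, T] `&` B =
    \bigcup_(t in [set` D']) (`]t - e t, t + e t[ `&` `[0, T] `&` B).
  apply/seteqP; split=> [s [[sT _] Bs]|s [t _ [[_ sT] Bs]]]; last by split.
  by have [t Dt ts] := cov _ sT; exists t.
have goodD t : t \in D' -> good `]t - e t, t + e t[.
  by move=> /D'T /set_mem; rewrite /= in_itv/= => /He[].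
split; last first.
  move=> z; rewrite covE; apply: fin_bigcup_measurable.
    exact: finite_fset.
  by move=> t /= /goodD[_]; exact.
have -> : `[0, T] `&` `[0, T] = `[0, T] `&` `[0, T] `&` setT by rewrite setIT.
rewrite covE image_bigcup; apply: bigcup_finite; first exact: finite_fset.
by move=> t /= /goodD[+ _]; rewrite setIT.
Qed.

Lemma cadlag_finite : finite_set (w @` `[0, T]).
Proof. by have [+ _] := good_itv; rewrite setIid. Qed.

Lemma cadlag_preimage z : measurable (`[0, T] `&` w @^-1` [set z]).
Proof. by have [_ /(_ z)] := good_itv; rewrite setIid. Qed.

Lemma cadlag_measurable (f : config d N -> R) :
  measurable_fun `[0, T] (f \o w).
Proof.
move=> mD Y mY.
have -> : `[0, T] `&` (f \o w) @^-1` Y =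
    \bigcup_(z in w @` `[0, T] `&` f @^-1` Y) (`[0, T] `&` w @^-1` [set z]).
  apply/seteqP; split=> [s [sT /= Ys]|s [z [_ /= Yz] [sT /= zs]]].
    by exists (w s) => //; split=> //; exists s.
  by split=> //=; rewrite zs.
apply: fin_bigcup_measurable; first exact: finite_setIl cadlag_finite.
by move=> z _; exact: cadlag_preimage.
Qed.

Lemma cadlag_bounded (f : config d N -> R) :
  exists B, forall t, 0 <= t <= T -> f (w t) <= B.
Proof.
have /finite_seqP[s sE] := cadlag_finite.
exists (\sum_(z <- s) `|f z|) => t tT.
have : w t \in s by have : (w @` `[0, T]) (w t) by [exists t; rewrite //= in_itv]; rewrite sE.
move=> ws; rewrite (le_trans (ler_norm _))// (big_rem (w t))//= lerDl.
exact: sumr_ge0.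
Qed.

End cadlag_theory.

Section empirical_path.
Variables (R : realType) (d : nat) (T : R) (N l : nat).

Section path.
Variable w : skorokhod d N T.

Lemma emp_path_measurable (F : C1 R d) :
  measurable_fun `[0, T] (fun t => emp R l (w t) F : R).
Proof. exact: (cadlag_measurable w (fun z => emp_fun l z F)). Qed.

Lemma emp_path_bounded : exists B : R,
  {ae @lebesgue_measure R, forall t, 0 <= t <= T ->
    forall F : C1 R d, `|emp R l (w t) F| <= B * `|F|}.
Proof.
have [B HB] := cadlag_bounded w (@emp_bound R d N l).
exists B; apply: aeW => t tT F.
by rewrite (le_trans (emp_fun_bounded _ _ _))// ler_wpM2r// HB.
Qed.

Definition emp_path := MkWpath emp_path_measurable emp_path_bounded.

End path.

(* The random element pi^{N,l} *)
Definition young_process (w : pathD d N T) : borel_Linfty d T :=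
  \pi_(Linfty d T) (emp_path w).

End empirical_path.

Section hypotheses.
Variables (R : realType) (d : nat).

(* [phi_c] may be infinite, as for [g k = k]. *)
Definition jump_rate (g : nat -> R) :=
  [/\ forall k, 0 <= g k,
      forall k, g k = 0 <-> k = 0%N,
      exists C : R, forall k, `|g k.+1 - g k| <= C &
      exists2 phi_c : \bar R, (0 < phi_c)%E &
        ((\prod_(1 <= i < k.+1) g i) `^ (k%:R^-1))%:E @[k --> \oo] --> phi_c].

Definition finite_first_moment N (mu0 : probability (config d N) R) :=
  (\int[mu0]_eta (num_particles eta)%:R%:E < +oo)%E.

Definition mass_in_probability (mu0 : forall N, probability (config d N) R)
    (mass : R) :=
  forall delta : R, 0 < delta ->
    mu0 N [set eta | delta < `|(N%:R ^+ d)^-1 * (num_particles eta)%:R - mass|]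
      @[N --> \oo] --> 0%E.

End hypotheses.

(* Main.v *)
Require Import Defs.
From mathcomp Require Import all_boot all_order all_algebra.
From mathcomp Require Import all_classical all_reals all_analysis.
From mathcomp Require Import measurable_realfun.
From mathcomp Require Import ring lra.
Import Order.TTheory GRing.Theory Num.Theory.
Import numFieldNormedType.Exports.

Local Open Scope classical_set_scope.
Local Open Scope ring_scope.

(** Write [b] for a block average and, for a cap [a >= 0], consider the expected time
    integral [e a] of the spatial average of [min b a]. The truncated excess is a
    difference of such quantities up to a factor: pointwise, with [M' = max M A],

      min b M * 1_{b > A}  <=  2 (min b M' - min b (A / 2))

    ([truncated_excess_le]), so its expectation is at most [2 (e M' - e (A / 2))].

    The function [l |-> min l a] is a bounded test function on the half line, and
    its pairing with the empirical path is confined to the interval [0, T a]; hence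
    [e a] is the integral of a bounded continuous function against the law of the
    Young process ([test_functional_law]). The assumed weak convergence thus
    gives [e a] an iterated limit [u a]. As [u] is non-decreasing and bounded, the
    iterated limsup of the excess is at most

      2 (u M' - u (A / 2))  <=  2 (sup u - u (A / 2)),

    which is free of [M] and tends to [0] as [A] grows.

    The bound [u a <= T (mass + 1)] is conservation of mass. The spatial average of [b]
    is the number of particles per site. This is constant along almost every path
    ([zrp_conserves]) and at most [mass + 1] at time [0] outside an event of
    vanishing probability, on which the cap gives the contribution [T a] times that
    probability ([expected_occupation_mass]).

    Conservation of mass has to be extracted from the description of the semigroup
    by its generator on bounded functions: the generator annihilates the indicators
    of the sets of configurations with a given number of particles, so the
    probability of leaving such a set in time [h] is [o(h)]; as it is also
    subadditive in time, it is zero ([semigroup_conserves]). *)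

(** * Conservation of the number of particles by the semigroup *)

(** The subtraction in [jump] is truncated, hence the particle at [x]; the case
    [y = x], which occurs on the torus with one site, is included. *)
Lemma jump_particles (d N : nat) (eta : config d N) (x y : site d N) :
  (0 < eta x)%N -> num_particles (jump eta x y) = num_particles eta.
Proof.
move=> ex; rewrite /num_particles.
have E z : (jump eta x y z + (z == x) = eta z + (z == y))%N.
  rewrite ffunE addnAC subnK//; case: eqP => [->//|_] //.
apply/eqP; rewrite -(eqn_add2r 1); apply/eqP.
have one (u : site d N) : (\sum_z (z == u : nat) = 1)%N.
  by rewrite (bigD1 u)//= eqxx big1 ?addn0// => z /negPf ->.
rewrite -{1}(one x) -{1}(one y) -!big_split /=.
by apply: eq_bigr => z _; exact: E.
Qed.

Definition off_sector {d N : nat} (n : nat) : set (config d N) :=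
  [set zeta | num_particles zeta != n].

Section conservation.
Context {R : realType} {d N : nat} {g : nat -> R} (g0 : g 0%N = 0).

(** A jump out of an empty site has rate [g 0 = 0] and all other jumps conserve
    the number of particles, so the generator only sees the values of [f] on the
    configurations with as many particles as [eta]. *)
Lemma generator_sector (eta : config d N) (f : config d N -> R) :
  (forall zeta, num_particles zeta = num_particles eta -> f zeta = f eta) ->
  generator g f eta = 0.
Proof.
move=> fE; rewrite /generator; apply/eqP; rewrite mulf_eq0; apply/orP; right.
apply/eqP; rewrite big1// => x _; rewrite big1// => j _.
have [ex|ex] := posnP (eta x); first by rewrite ex g0 !mul0r addr0.
by rewrite !fE ?subrr ?mulr0 ?addr0// jump_particles.
Qed.

(** The generator vanishes at [eta] on the indicator of [off_sector n], so the
    probability of leaving the sector within time [h] is [o(h)]; this is uniform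
    over the sector because a sector is finite. *)
Lemma semigroup_off_small {p} (n : nat) {e : R} : is_semigroup g p -> 0 < e ->
  exists2 r, 0 < r & forall h, 0 < h < r -> forall eta : config d N,
    num_particles eta = n -> (p h eta (off_sector n) <= (e * h)%:E)%E.
Proof.
move=> [_ _ pG] e0.
have : \forall h \near 0^'+, forall c : {ffun site d N -> 'I_n.+1},
    num_particles ([ffun x => c x : nat] : config d N) = n ->
    (p h [ffun x => c x : nat] (off_sector n) <= (e * h)%:E)%E.
  (* no site holds more than [n] of the [n] particles, hence the finite type *)
  apply: filter_forall => c.
  have [etan|etan] := pselect (num_particles
      ([ffun x => c x : nat] : config d N) = n); last by apply: nearW => h /etan.
  pose eta : config d N := [ffun x => c x : nat].
  have := pG (\1_(off_sector n)) eta.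
  rewrite generator_sector; last first.
    move=> zeta zE; rewrite !indicE; congr ((_ : bool)%:R).
    by apply: asbool_equiv_eq; rewrite /off_sector/= zE.
  have -> : \1_(off_sector n) eta = 0 :> R
    by rewrite indicE memNset// /off_sector/= etan eqxx.
  have B1 : exists B : R, forall z : config d N, `|(\1_(off_sector n) z : R)| <= B.
    by exists 1 => z; rewrite indicE; case: (_ \in _); rewrite ?normr1 ?normr0.
  move=> /(_ B1) /cvgrPdist_lt /(_ _ e0) near_e.
  near=> h => _.
  have h0 : 0 < h by near: h; exact: nbhs_right_gt.
  have : `|0 - h^-1 * (\int[p h eta]_(z in setT) \1_(off_sector n) z - 0)| < e.
    by near: h; exact: near_e.
  rewrite /Rintegral integral_indic// setIT subr0 sub0r normrN normrM.
  rewrite (ger0_norm (fine_ge0 _))// gtr0_norm ?invr_gt0//.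
  rewrite ltr_pdivrMl// mulrC => /ltW.
  by rewrite -lee_fin fineK// fin_num_measure.
move=> /nbhs_ballP[r /= r0 Hr]; exists r => // h /andP[h0 hr] eta etan.
have le_n (x : site d N) : (eta x < n.+1)%N.
  by rewrite ltnS -etan /num_particles (bigD1 x)//= leq_addr.
have := Hr h; rewrite /ball/= sub0r normrN gtr0_norm// => /(_ hr h0).
move=> /(_ [ffun x => Ordinal (le_n x)])/=.
have -> : [ffun x => [ffun x => Ordinal (le_n x)] x : nat] = eta.
  by apply/ffunP => x; rewrite !ffunE.
exact.
Unshelve. all: by end_near. Qed.

(** By the Chapman-Kolmogorov equation, the largest probability over the sector of
    being outside of it is a subadditive function of time. *)
Lemma semigroup_off_subadditive {p} {n : nat} (j : nat) {h c : R} : is_semigroup g p ->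
  0 < h -> 0 <= c ->
  (forall eta : config d N, num_particles eta = n ->
    (p h eta (off_sector n) <= c%:E)%E) ->
  forall eta : config d N, num_particles eta = n ->
    (p (j%:R * h)%R eta (off_sector n) <= (j%:R * c)%:E)%E.
Proof.
move=> [p0 pD _] h0 c0 small; elim: j => [|j IH] eta etan.
  by rewrite !mul0r p0 diracE memNset// /off_sector/= etan eqxx.
have jh0 : 0 <= j%:R * h by rewrite mulr_ge0// ltW.
rewrite -natr1 !mulrDl !mul1r addrC pD ?(ltW h0)// [X in (_ <= X%:E)%E]addrC.
apply: (@le_trans _ _
    (\int[p h eta]_zeta ((\1_(off_sector n) zeta)%:E + (j%:R * c)%:E))%E).
  apply: ge0_le_integral => //.
    move=> zeta _; have [zn|zn] := eqVneq (num_particles zeta) n.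
      by rewrite (le_trans (IH _ zn))// leeDr// lee_fin.
    rewrite indicE mem_set//= (le_trans (probability_le1 _ _))//.
    by rewrite leeDl// lee_fin mulr_ge0.
rewrite ge0_integralD//; last by move=> z _; rewrite lee_fin mulr_ge0.
rewrite integral_indic// setIT integral_cst// [X in (_ * X)%E]probability_setT.
by rewrite mule1 EFinD leeD2r// small.
Qed.

(** A subadditive function of time that is [o(h)] at [0] vanishes. This replaces a
    uniqueness theorem for the Kolmogorov equations, the rates being unbounded. *)
Lemma semigroup_conserves {p} {n : nat} {t : R} {eta : config d N} :
  is_semigroup g p -> 0 <= t -> num_particles eta = n -> p t eta (off_sector n) = 0%E.
Proof.
move=> sp t0 etan; apply/eqP; rewrite eq_le measure_ge0 andbT.
move: t0; rewrite [0 <= t]le_eqVlt => /predU1P[<-|t0].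
  by case: sp => p0 _ _; rewrite p0 diracE memNset// /off_sector/= etan eqxx.
apply/lee_addgt0Pr => e e0; rewrite add0e.
have et0 : 0 < e / t by rewrite divr_gt0.
have [r r0 Hr] := semigroup_off_small n sp et0.
(* [j] steps of length [t / j], with [t / j < r] *)
pose j := (Num.truncn (t / r)).+1.
have j0 : 0 < j%:R :> R by rewrite ltr0n.
have hr : 0 < t / j%:R < r.
  rewrite divr_gt0//= ltr_pdivrMr// -ltr_pdivrMl// mulrC.
  by rewrite /j truncnS_gt.
have h0 : 0 < t / j%:R by case/andP: hr.
have c0 : 0 <= e / t * (t / j%:R) by rewrite mulr_ge0// ltW.
have := semigroup_off_subadditive j sp h0 c0 (Hr _ hr) _ etan.
rewrite (_ : j%:R * (t / j%:R) = t); last by rewrite mulrC divfK// gt_eqF.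
rewrite (_ : j%:R * _ = e)//; field.
by rewrite !gt_eqF.
Qed.

End conservation.

(** * Conservation of the number of particles along the paths *)

Section path_law.
Context {R : realType} {d N : nat} {T : R}.
Implicit Type w : skorokhod d N T.

Lemma cylinder_measurable (t : R) (B : set (config d N)) : 0 <= t <= T ->
  measurable ([set w | B (w t)] : set (pathD d N T)).
Proof.
move=> tT; rewrite [X in measurable X](_ : _ = \bigcup_(z : config d N)
    [set w : skorokhod d N T | w t = z /\ B z]); last first.
  by apply/seteqP; split=> [w Bw|w [z _ [/= wz Bz]]]; [exists (w t)|rewrite /= wz].
apply: countable_bigcupT_measurable.
  exact: (@countableP {ffun site d N -> nat} setT).
move=> z; have [Bz|Bz] := pselect (B z).
  by apply: sub_sigma_algebra; exists t, z; split => //; apply/seteqP; split=> w /=; [case|].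
by rewrite (_ : mkset _ = set0)//; apply/seteqP; split => w /= [].
Qed.

Hypothesis T0 : 0 <= T.
Context {g : nat -> R} {mu0 : probability (config d N) R}
  {P : probability (pathD d N T) R}.
Hypotheses (g0 : g 0%N = 0) (zP : is_zrp g mu0 P).

Lemma zrp_initial_law (B : set (config d N)) :
  P [set w | B (w 0)] = mu0 B.
Proof.
have [p _ fdd] := zP.
have T00 : 0 <= (0 : R) <= T by rewrite lexx.
have E z : P [set w | w 0 = z] = mu0 [set z].
  have := fdd 0%N (fun=> 0) (fun=> z) erefl (fun _ _ => lexx _) T0.
  rewrite big_ord0 mule1 => <-; congr (P _).
  by apply/seteqP; split=> w /=; [move=> wz|move=> /(_ 0%N); apply].
(* [F] cuts [B] into singletons and empty sets, numbered by [pickle] *)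
pose F n : set (config d N) :=
  [set z | B z /\ pickle (z : {ffun site d N -> nat}) = n].
have FE n : P [set w | F n (w 0)] = mu0 (F n).
  have [[z [Bz zn]]|nF] := pselect (exists z, F n z).
    have -> : F n = [set z]; last exact: E.
    apply/seteqP; split=> [z' [_]|_ ->]; last by split.
    by rewrite -zn => /(pcan_inj pickleK).
  have -> : F n = set0 by apply/seteqP; split => // z Fz; apply: nF; exists z.
  by rewrite (_ : mkset _ = set0)// !measure0.
have BE : B = \bigcup_n F n.
  by apply/seteqP; split=> [z Bz|z [n _ []]] //; exists (pickle (z : {ffun site d N -> nat})).
have tF : trivIset setT F.
  by move=> i j _ _ [z [[_ <-] [_ <-]]].
rewrite {2}BE measure_bigcup//.
rewrite [X in P X](_ : _ = \bigcup_n [set w : skorokhod d N T | F n (w 0)]); last first.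
  by apply/seteqP; split=> [w /=|w [n _ []]] //; rewrite {1}BE => -[n ? ?]; exists n.
rewrite measure_bigcup//.
- by apply: eq_eseriesr => n _; exact: FE.
- by move=> n _; exact: (cylinder_measurable 0 (F n) T00).
- by move=> i j _ _ [w [[_ <-] [_ <-]]].
Qed.

Lemma zrp_conserves_at (t : R) : 0 <= t <= T ->
  P.-negligible [set w | num_particles (w t) != num_particles (w 0)].
Proof.
move=> /[dup] tT /andP[t0 tT'].
have [p sp fdd] := zP.
pose cT := ({ffun site d N -> nat} * {ffun site d N -> nat})%type.
pose F n := [set w : skorokhod d N T |
  num_particles (w t) != num_particles (w 0) /\
  pickle ((w 0, w t) : cT) = n].
rewrite [X in P.-negligible X](_ : _ = \bigcup_n F n); last first.
  by apply/seteqP; split=> [w ?|w [n _ []]] //; exists (pickle ((w 0, w t) : cT)).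
apply: negligible_bigcup => n.
have [[w [wt wn]]|nF] := pselect (exists w, F n w); last first.
  rewrite (_ : F n = set0); first exact: negligible_set0.
  by apply/seteqP; split=> // w Fw; apply: nF; exists w.
have T00 : 0 <= (0 : R) <= T by rewrite lexx.
exists ([set w' : skorokhod d N T | w' 0 = w 0] `&` [set w' : skorokhod d N T | w' t = w t]); split.
- apply: measurableI.
    exact: (cylinder_measurable 0 [set z | z = w 0] T00).
  exact: (cylinder_measurable t [set z | z = w t] tT).
- pose tt i := if i == 0%N then 0 else t.
  pose z i := if i == 0%N then w 0 else w t.
  have tt1 i : (i < 1)%N -> tt i <= tt i.+1 by case: i.
  have := fdd 1%N tt z erefl tt1 tT'.
  rewrite big_ord1/= /tt/= subr0 /z/=.
  set a := (p _ _ _); have -> : a = 0%E.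
    apply/eqP; rewrite eq_le measure_ge0 andbT.
    rewrite -(semigroup_conserves g0 sp t0 (erefl (num_particles (w 0)))).
    apply: le_measure; rewrite ?inE// => _ ->; exact: wt.
  rewrite mule0 => <-; congr (P _); apply/seteqP; split=> w' /=.
    by move=> [w0 w1] [|[|]].
  by move=> ww'; split; [exact: (ww' 0%N)|exact: (ww' 1%N)].
- by move=> w' [_]; rewrite -wn => /(pcan_inj pickleK)[e0 et]; split.
Qed.

(** Conservation at the countably many rational times suffices: paths are right
    continuous and integer-valued on each site, so the configuration at time [t]
    is also the one at some later rational time. *)
Lemma zrp_conserves_before :
  {ae P, forall w, forall t, 0 <= t < T ->
    num_particles (w t) = num_particles (w 0)}.
Proof.
pose F n : set (pathD d N T) := if unpickle n is Some q then
  if 0 <= (ratr q : R) <= T then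
    [set w | num_particles (w (ratr q)) != num_particles (w 0)]
  else set0 else set0.
have /negligible_bigcup : forall n, P.-negligible (F n).
  move=> n; rewrite /F; case: unpickle => [q|]; last exact: negligible_set0.
  by case: ifPn => [/zrp_conserves_at//|_]; exact: negligible_set0.
apply: negligibleS => w /=.
move=> /existsNP[t] /not_implyP[/andP[t0 tT] /eqP wt].
have t0T : 0 <= t <= T by rewrite t0 ltW.
have [e e0 He] := cadlag_right w t0T.
have tm : t < Num.min T (t + e) by rewrite lt_min tT ltrDl.
have [q] := rat_in_itvoo tm; rewrite in_itv/= lt_min => /andP[tq /andP[qT qe]].
have qT' : 0 <= (ratr q : R) <= T by rewrite (le_trans t0 (ltW tq)) ltW.
have wq : w (ratr q) = w t.
  by apply: He; rewrite ?(ltW tq) ?qe// ltW.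
exists (pickle q); first exact: I.
by rewrite /F pickleK qT' /mkset wq.
Qed.

Lemma zrp_conserves :
  {ae P, forall w, forall t, 0 <= t <= T ->
    num_particles (w t) = num_particles (w 0)}.
Proof.
have TT : 0 <= T <= T by rewrite T0 lexx.
have := negligibleU zrp_conserves_before (zrp_conserves_at T TT).
apply: negligibleS => w /existsNP[t] /not_implyP[/andP[t0 tT] wt].
move: tT; rewrite le_eqVlt => /predU1P[tT|tT]; [right|left].
  by move: wt; rewrite tT => /eqP.
by move=> /(_ t); rewrite t0 => /(_ tT).
Qed.

End path_law.

(** * Measurability of occupation integrals *)

Section occupation.
Context {R : realType} {d N : nat} {T : R}.
Hypothesis T0 : 0 <= T.
Variable f : config d N -> R.

Let grid (n i : nat) : R := Num.min T (i.+1%:R / n.+1%:R).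

(** The first point after [t] of the mesh of step [1 / (n + 1)], cut off at [T]. *)
Let later (n : nat) (t : R) : R := grid n (Num.truncn (n.+1%:R * t)).

Lemma grid_bound n i : 0 <= grid n i <= T.
Proof. by rewrite le_min T0 divr_ge0//= ge_min lexx. Qed.

Lemma later_measurable n :
  measurable_fun ([set: pathD d N T] `*` `[0, T])
    (fun wt : pathD d N T * R => f (wt.1 (later n wt.2))).
Proof.
move=> _ Y mY.
rewrite [X in measurable X](_ : _ = \bigcup_i
    ([set w : pathD d N T | Y (f (w (grid n i)))] `*`
     (`[0, T] `&` `[i%:R / n.+1%:R, i.+1%:R / n.+1%:R[))).
  apply: bigcup_measurable => i _; apply: measurableX.
    exact: (cylinder_measurable _ [set z | Y (f z)] (grid_bound n i)).
  by apply: measurableI; exact: measurable_itv.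
have cell (t : R) (i : nat) : 0 <= t ->
    (Num.truncn (n.+1%:R * t) == i) = (i%:R / n.+1%:R <= t < i.+1%:R / n.+1%:R).
  move=> t0; rewrite truncn_eq ?mulr_ge0//.
  by rewrite ler_pdivrMr// ltr_pdivlMr// [t * _]mulrC.
apply/seteqP; split=> [[w t] [[_ /= tT] Yw]|[w t] [i _ [/= Yw [tT ti]]]].
  exists (Num.truncn (n.+1%:R * t)) => //; split => //=; split=> //.
  by move: tT; rewrite !in_itv/= => /andP[t0 _]; rewrite -cell.
split => //=; rewrite /later.
move: tT ti; rewrite !in_itv/= => /andP[t0 _]; rewrite -cell// => /eqP ->.
exact: Yw.
Qed.

(** The mesh approaches [t] from the right, where the path is locally constant, and
    the cutoff at [T] makes the statement true at the end point. *)
Lemma later_cvg (w : skorokhod d N T) (t : R) : 0 <= t <= T ->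
  f (w (later n t)) @[n --> \oo] --> f (w t).
Proof.
move=> /[dup] tT /andP[t0 tleT].
have [e e0 He] := cadlag_right w tT.
apply: cvg_near_cst; near=> n; congr (f _).
have n0 : 0 < n.+1%:R :> R by [].
have tn : t < (Num.truncn (n.+1%:R * t)).+1%:R / n.+1%:R.
  by rewrite ltr_pdivlMr// mulrC truncnS_gt.
apply: He; last by rewrite ge_min lexx.
apply/andP; split; first by rewrite le_min tleT ltW.
rewrite /later /grid gt_min; apply/orP; right.
rewrite ltr_pdivrMr// -natr1 mulrDl mulrC.
apply: ler_ltD; first by rewrite mulrC truncn_le mulr_ge0.
rewrite -ltr_pdivrMl// mulr1.
apply: (lt_trans (truncnS_gt _)); rewrite ltr_nat ltnS.
near: n; exact: nbhs_infty_gt.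
Unshelve. all: by end_near. Qed.

(** The cylinders only see one time at once; right continuity turns this into joint
    measurability in the path and the time. *)
Lemma joint_measurable :
  measurable_fun ([set: pathD d N T] `*` `[0, T])
    (fun wt : pathD d N T * R => f (wt.1 wt.2)).
Proof.
apply: (@measurable_fun_cvg _ (pathD d N T * R)%type R _
  (fun n wt => f (wt.1 (later n wt.2)))).
  exact: later_measurable.
by move=> [w t] [_ /=]; rewrite in_itv/=; exact: later_cvg.
Qed.

Hypothesis f0 : forall z, 0 <= f z.

Lemma occupation_measurable :
  measurable_fun [set: pathD d N T] (fun w : pathD d N T =>
    \int[lebesgue_measure]_(t in `[0%R, T]) (f (w t))%:E)%E.
Proof.
set D : set (pathD d N T * R) := [set: pathD d N T] `*` `[0%R, T].
have mD : measurable D by apply: measurableX => //; exact: measurable_itv.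
pose F := (fun wt : pathD d N T * R => (f (wt.1 wt.2))%:E) \_ D.
have mF : measurable_fun setT F.
  apply/(measurable_restrictT _ mD).
  by apply/measurable_EFinP; exact: joint_measurable.
have F0 x : (0 <= F x)%E by apply: erestrict_ge0 => y _; rewrite lee_fin.
have := @measurable_fun_fubini_tonelli_F _ _ _ _ _ lebesgue_measure F mF F0.
apply: eq_measurable_fun => w _; rewrite /fubini_F [RHS]integral_mkcond.
apply: eq_integral => t _; rewrite /F !patchE.
by congr (if _ then _ else _); apply/idP/idP => /set_mem H; apply/mem_set => //; case: H.
Qed.

End occupation.

(** * Truncated identities as test functions *)

Section cutoff.
Context {R : realType} {d : nat}.
Variable a : R.

(** The test functions of the whole proof; they are bounded, so they have recession
    function [0]. *)
Definition cutoff_fun (p : torus R d * halfline R) : R^o := Num.min (\val p.2) a.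

Lemma cutoff_fun_le p : `|cutoff_fun p| <= `|a|.
Proof.
rewrite /cutoff_fun; have l0 := halfline_ge0 p.2.
case: (lerP (\val p.2) a) => // la.
by rewrite ger0_norm// ger0_norm// (le_trans l0).
Qed.

Lemma cutoff_funP : cutoff_fun \in @C1_pred R d.
Proof.
apply/mem_set; split.
  move=> p.
  have c1 : {for p, continuous (fun q : torus R d * halfline R => \val q.2 : R^o)}.
    apply: (@continuous_comp _ _ _ snd (\val : halfline R -> R)).
      exact: cvg_snd.
    exact: initial_continuous.
  exact: (@continuous_min R _ _ (fun=> a) p c1 (cvg_cst _)).
exists (fun=> 0); split=> [u|e e0]; first exact: cst_continuous.
exists (`|a| / e) => u l al; rewrite subr0.
have l0 : 0 < 1 + \val l := C1_weight_gt0 l.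
rewrite normrM normfV (gtr0_norm l0) ler_pdivrMr//.
rewrite (le_trans (cutoff_fun_le _))// mulrDr mulr1 ler_wpDl ?(ltW e0)//.
by rewrite mulrC -ler_pdivrMr.
Qed.

Definition cutoff : C1 R d := MkC1 cutoff_funP.

Lemma cutoff_bochner (T : R) : bochner_integrable T (fun=> cutoff).
Proof.
split.
  exists (fun _ _ => cutoff); split.
    move=> n; split.
      by apply: (sub_finite_set (B := [set cutoff])) => // _ [t _ <-].
    move=> c; have [<-|cc] := pselect (cutoff = c).
      rewrite (_ : _ @^-1` _ = setT) ?setIT//; last by apply/seteqP; split.
    rewrite (_ : _ @^-1` _ = set0) ?setI0//.
    by apply/seteqP; split.
  by move=> t _; exact: cvg_cst.
rewrite integral_cst//= lebesgue_measure_itv/=.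
by case: ifP => _; rewrite ?mule0// -EFinB -EFinM ltry.
Qed.

Definition cutoff_path (T : R) : L1_C1 d T := exist _ _ (cutoff_bochner T).

End cutoff.

(** The pairings are the coordinates that generate the weak-star topology. *)
Lemma pairing_continuous {R : realType} {d : nat} {T : R} (F : L1_C1 d T) :
  continuous (pairing F : Linfty d T -> R).
Proof.
move=> p.
apply: (@continuous_comp _ {ptws L1_C1 d T -> R} _
  (fun p F => pairing F p) (fun h => h F)).
  exact: initial_continuous.
(* the product topology is the supremum of the topologies of the projections *)
have /cvg_sup/(_ F) hF : nbhs ((fun G => pairing G p) : {ptws L1_C1 d T -> R}) -->
  ((fun G => pairing G p) : {ptws L1_C1 d T -> R}) by exact: cvg_id.
move=> A nA; apply: hF.
exact: (@initial_continuous (L1_C1 d T -> R) R (fun h => h F) _ A nA).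
Qed.

Definition capped_density {R : realType} {d N : nat} (l : nat) (a : R)
    (eta : config d N) : R :=
  (N%:R ^+ d)^-1 * \sum_x Num.min (block_avg R l eta x) a.

Lemma emp_cutoff {R : realType} {d N : nat} (l : nat) (a : R) (eta : config d N) :
  emp R l eta (cutoff a) = capped_density l a eta.
Proof.
rewrite /=; congr (_ * _); apply: eq_bigr => x _.
rewrite [LHS](_ : _ = Num.min (Num.max 0 (block_avg R l eta x)) a)//.
by rewrite max_r// block_avg_ge0.
Qed.

(** The representative chosen in the class of the empirical path agrees with it for
    almost every time, which the integral does not notice. *)
Lemma pairing_young {R : realType} {d N : nat} {T : R} (l : nat) (a : R)
    (w : pathD d N T) :
  pairing (cutoff_path a T) (young_process l w) =
  \int[lebesgue_measure]_(t in `[0, T]) capped_density l a (w t).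
Proof.
rewrite /pairing /Rintegral; congr fine.
under [RHS]eq_integral do rewrite -emp_cutoff.
apply: ae_eq_integral => //.
- apply/measurable_EFinP.
  exact: (@wpath_measurable R d T (repr (young_process l w)) (cutoff a)).
- by apply/measurable_EFinP; exact: emp_path_measurable.
have /eqmodP/asboolP : (repr (young_process l w) = emp_path l w %[mod Linfty d T])%qT.
  by rewrite reprK.
apply: (@filterS _ _ (ae_filter_ringOfSetsType (@lebesgue_measure R))).
by move=> t /= h Dt; rewrite h.
Qed.

(** * Capped densities *)

Section densities.
Context {R : realType} {d N : nat}.
Variable l : nat.
Hypothesis N0 : (0 < N)%N.
Implicit Type eta : config d N.

Let vol0 : 0 <= (N%:R ^+ d : R)^-1. Proof. by rewrite invr_ge0 exprn_ge0. Qed.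

(** Each of the translations that make up the block average is a bijection of the
    discrete torus. *)
Lemma sum_block_avg eta :
  \sum_x block_avg R l eta x = (num_particles eta)%:R.
Proof.
rewrite /block_avg -mulr_sumr exchange_big/=.
under eq_bigr => y _.
  rewrite (_ : \sum_x _ = (num_particles eta)%:R); last first.
    rewrite -natr_sum; congr (_%:R).
    rewrite [RHS](reindex_inj (addIr ([ffun i => inZp (y i)] - [ffun=> inZp l])))/=.
    by apply: eq_bigr => x _; rewrite addrA.
  over.
rewrite sumr_const card_ffun !card_ord -[X in _ * X]mulr_natl mulrA natrX mulVf ?mul1r//.
Qed.

Lemma site_average_cst (a : R) : (N%:R ^+ d)^-1 * \sum_(x : site d N) a = a.
Proof.
rewrite sumr_const card_ffun !card_ord prednK// -[X in _ * X]mulr_natl mulrA natrX.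
by rewrite mulVf ?mul1r// expf_neq0// pnatr_eq0 -lt0n.
Qed.

Lemma capped_density_ge0 (a : R) eta : 0 <= a -> 0 <= capped_density l a eta.
Proof.
move=> a0; rewrite mulr_ge0// sumr_ge0// => x _.
by rewrite le_min block_avg_ge0.
Qed.

Lemma capped_density_le_cap (a : R) eta : capped_density l a eta <= a.
Proof.
rewrite -[leRHS]site_average_cst ler_wpM2l// ler_sum// => x _.
by rewrite ge_min lexx orbT.
Qed.

Lemma capped_density_le_mass (a : R) eta :
  capped_density l a eta <= (N%:R ^+ d)^-1 * (num_particles eta)%:R.
Proof.
by rewrite ler_wpM2l// -sum_block_avg ler_sum// => x _; rewrite ge_min lexx.
Qed.

Lemma capped_density_homo (a b : R) eta : a <= b ->
  capped_density l a eta <= capped_density l b eta.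
Proof.
move=> ab; rewrite ler_wpM2l// ler_sum// => x _.
by rewrite le_min !ge_min lexx ab orbT.
Qed.

Lemma truncated_excess_ge0 (A M : R) eta : 0 <= M ->
  0 <= truncated_excess l A M eta.
Proof.
move=> M0; rewrite mulr_ge0// sumr_ge0// => x _.
by rewrite mulr_ge0// le_min block_avg_ge0.
Qed.

(** Pointwise, with [M'] the maximum of [M] and [A]: if [A < b] then
    [min b M' >= A], so that subtracting [A / 2] from [min b M'] leaves at least half
    of it; if [b <= A] the excess is [0] and
    [min b (A / 2) <= min b M']. *)
Lemma truncated_excess_le (A M : R) eta : 0 <= A ->
  truncated_excess l A M eta +
    (capped_density l (A / 2) eta + capped_density l (A / 2) eta) <=
  capped_density l (Num.max M A) eta + capped_density l (Num.max M A) eta.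
Proof.
move=> A0; rewrite -!mulrDr ler_wpM2l// -!big_split/= ler_sum// => x _.
have := block_avg_ge0 R l eta x; move: (block_avg _ _ _ _) => b b0.
case: (ltP A b) => Ab; rewrite ?mulr1 ?mulr0 ?add0r;
rewrite /Num.min /Num.max; repeat case: ifPn; rewrite -?leNgt; lra.
Qed.

End densities.

(** * Expected occupation integrals *)

Section expectation.
Context {R : realType} {d N : nat} {T : R}.
Hypothesis T0 : 0 <= T.
Variable P : probability (pathD d N T) R.
Implicit Types f h : config d N -> R.

Definition expected_occupation f : \bar R :=
  (\int[P]_w \int[lebesgue_measure]_(t in `[0%R, T]) (f (w t))%:E)%E.

Lemma path_measurable f (w : skorokhod d N T) :
  measurable_fun `[0, T] (fun t => (f (w t))%:E).
Proof. by apply/measurable_EFinP; exact: (cadlag_measurable w f). Qed.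

Lemma occupation_ge0 f (w : skorokhod d N T) : (forall z, 0 <= f z) ->
  (0 <= \int[lebesgue_measure]_(t in `[0%R, T]) (f (w t))%:E)%E.
Proof. by move=> f0; apply: integral_ge0 => t _; rewrite lee_fin. Qed.

Lemma occupation_le f h (w : skorokhod d N T) : (forall z, 0 <= f z) ->
  (forall z, f z <= h z) ->
  (\int[lebesgue_measure]_(t in `[0%R, T]) (f (w t))%:E <=
   \int[lebesgue_measure]_(t in `[0%R, T]) (h (w t))%:E)%E.
Proof.
move=> f0 fh; apply: ge0_le_integral => //.
- by move=> t _; rewrite lee_fin.
- exact: path_measurable.
- exact: path_measurable.
- by move=> t _; rewrite lee_fin.
Qed.

Lemma occupation_cst (c : R) :
  (\int[lebesgue_measure]_(t in `[0%R, T]) c%:E = (T * c)%:E)%E.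
Proof.
rewrite integral_cst//= lebesgue_measure_itv/= lte_fin.
have [T1|T1] := ltP 0 T; first by rewrite -EFinB -EFinM subr0 mulrC.
have -> : T = 0 by apply/eqP; rewrite eq_le T0 T1.
by rewrite mule0 mul0r.
Qed.

Lemma expected_occupation_ge0 f : (forall z, 0 <= f z) ->
  (0 <= expected_occupation f)%E.
Proof. by move=> f0; apply: integral_ge0 => w _; exact: occupation_ge0. Qed.

Lemma expected_occupation_le f h : (forall z, 0 <= f z) ->
  (forall z, f z <= h z) -> (expected_occupation f <= expected_occupation h)%E.
Proof.
move=> f0 fh; have h0 z : 0 <= h z := le_trans (f0 z) (fh z).
apply: ge0_le_integral => //.
- by move=> w _; exact: occupation_ge0.
- exact: occupation_measurable.
- exact: occupation_measurable.
- by move=> w _; exact: occupation_le.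
Qed.

Lemma expected_occupationD f h : (forall z, 0 <= f z) -> (forall z, 0 <= h z) ->
  expected_occupation (fun z => f z + h z) =
  (expected_occupation f + expected_occupation h)%E.
Proof.
move=> f0 h0; rewrite -ge0_integralD//.
- apply: eq_integral => w _; rewrite -ge0_integralD//.
  + by move=> t _; rewrite lee_fin.
  + exact: path_measurable.
  + by move=> t _; rewrite lee_fin.
  + exact: path_measurable.
- by move=> w _; exact: occupation_ge0.
- exact: occupation_measurable.
- by move=> w _; exact: occupation_ge0.
- exact: occupation_measurable.
Qed.

Lemma expected_occupation_cst (c : R) : 0 <= c ->
  expected_occupation (fun=> c) = (T * c)%:E.
Proof.
move=> c0; rewrite /expected_occupation; under eq_integral do rewrite occupation_cst.
by rewrite integral_cst// [X in (_ * X)%E]probability_setT mule1.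
Qed.

Lemma expected_occupation_fin f (B : R) : (forall z, 0 <= f z <= B) ->
  expected_occupation f \is a fin_num.
Proof.
move=> fB; have f0 z : 0 <= f z by case/andP: (fB z).
have B0 : 0 <= B by apply: (le_trans (f0 [ffun=> 0%N])); case/andP: (fB [ffun=> 0%N]).
rewrite ge0_fin_numE; last exact: expected_occupation_ge0.
apply: (@le_lt_trans _ _ (expected_occupation (fun=> B))).
  by apply: expected_occupation_le => // z; case/andP: (fB z).
by rewrite expected_occupation_cst// ltry.
Qed.

End expectation.

(** On the event that the initial density is not within [1] of [mass], the cap [a]
    bounds the density at all times; off this event conservation of mass does. The second term
    on the right vanishes as [N] grows, whereas the first is free of [a]. *)
Lemma expected_occupation_mass {R : realType} {d N : nat} {T : R} (T0 : 0 <= T)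
    (l : nat) {g : nat -> R} {mu0 : probability (config d N) R}
    {P : probability (pathD d N T) R} (N0 : (0 < N)%N) (g0 : g 0%N = 0)
    (zP : is_zrp g mu0 P) (mass a : R) : 0 <= mass -> 0 <= a ->
  (expected_occupation P (capped_density l a) <=
   (T * (mass + 1))%:E + (T * a)%:E *
     mu0 [set eta | (1 < `|(N%:R ^+ d)^-1 * (num_particles eta)%:R - mass|)%R])%E.
Proof.
move=> mass0 a0.
set B : set (config d N) := [set eta | _].
have m1 : 0 <= T * (mass + 1) by rewrite mulr_ge0// addr_ge0.
have mB : measurable [set w : pathD d N T | B (w 0)].
  by apply: (cylinder_measurable 0 B); rewrite lexx.
apply: (@le_trans _ _ (\int[P]_w ((T * (mass + 1))%:E +
    (T * a)%:E * (\1_[set w : pathD d N T | B (w 0)] w)%:E))%E).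
  apply: ae_ge0_le_integral => //.
  - by move=> w _; apply: occupation_ge0 => z; exact: capped_density_ge0.
  - by apply: occupation_measurable => // z; exact: capped_density_ge0.
  - by move=> w _; rewrite adde_ge0// lee_fin// mulr_ge0// mulr_ge0.
  - apply: emeasurable_funD => //; apply: emeasurable_funM => //.
    by apply/measurable_EFinP; exact: measurable_indic.
  have := zrp_conserves T0 g0 zP.
  apply: (@filterS _ _ (ae_filter_ringOfSetsType P)) => w cw _.
  have [Bw|Bw] := pselect (B (w 0)).
    rewrite indicE mem_set//= mule1 (le_trans _ (leeDr _ _))//.
    rewrite -(occupation_cst T0 a).
    apply: occupation_le => z; [exact: capped_density_ge0|exact: capped_density_le_cap].
  rewrite indicE memNset//= mule0 adde0 -(occupation_cst T0).
  apply: ge0_le_integral => //.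
  - by move=> t _; rewrite lee_fin; exact: capped_density_ge0.
  - exact: path_measurable.
  move=> t /=; rewrite in_itv/= lee_fin => /cw wt.
  rewrite (le_trans (capped_density_le_mass _ _ _))// wt.
  move/negP : Bw; rewrite /B/= -leNgt => /(le_trans (ler_norm _)).
  by rewrite lerBlDl.
rewrite ge0_integralD//; last 2 first.
- by move=> w _; rewrite mule_ge0// lee_fin// mulr_ge0.
- by apply: emeasurable_funM => //; apply/measurable_EFinP; exact: measurable_indic.
rewrite integral_cst// [X in (_ * X + _)%E]probability_setT mule1.
rewrite ge0_integralZl//; last 2 first.
- by apply/measurable_EFinP; exact: measurable_indic.
- by rewrite lee_fin mulr_ge0.
by rewrite integral_indic// setIT -(zrp_initial_law T0 zP B).
Qed.

Lemma expected_capped_fin {R : realType} {d N : nat} {T : R} (T0 : 0 <= T)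
    (l : nat) (P : probability (pathD d N T) R) (N0 : (0 < N)%N) (a : R) :
  0 <= a -> expected_occupation P (capped_density l a) \is a fin_num.
Proof.
move=> a0; apply: (@expected_occupation_fin _ _ _ _ T0 _ _ a) => z.
by rewrite capped_density_ge0//= capped_density_le_cap.
Qed.

(** The excess is controlled by the density between the levels [A / 2] and
    [max M A], which is a difference of two quantities with limits. *)
Lemma expected_excess_le {R : realType} {d N : nat} {T : R} (T0 : 0 <= T)
    (l : nat) (P : probability (pathD d N T) R) (N0 : (0 < N)%N) (A M : R) :
  0 < A -> 0 < M ->
  (expected_occupation P (truncated_excess l A M) <=
   (2 * (fine (expected_occupation P (capped_density l (Num.max M A))) -
         fine (expected_occupation P (capped_density l (A / 2)))))%:E)%E.
Proof.
move=> A0 M0; have A20 : 0 <= A / 2 by rewrite divr_ge0 ?(ltW A0).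
have MA0 : 0 <= Num.max M A by rewrite le_max (ltW M0).
set c1 : config d N -> R := capped_density l (A / 2).
set c2 : config d N -> R := capped_density l (Num.max M A).
have c10 z : 0 <= c1 z by exact: capped_density_ge0.
have c20 z : 0 <= c2 z by exact: capped_density_ge0.
have t0 (z : config d N) : 0 <= truncated_excess l A M z :> R.
  by apply: truncated_excess_ge0; exact: ltW.
have : (expected_occupation P (fun z => truncated_excess l A M z + (c1 z + c1 z))%R <=
        expected_occupation P (fun z => c2 z + c2 z)%R)%E.
  apply: expected_occupation_le => // z; first by rewrite !addr_ge0.
  by apply: truncated_excess_le; exact: ltW.
rewrite !expected_occupationD//; last by move=> z; rewrite addr_ge0.
have /fineK := expected_capped_fin T0 l P N0 (A / 2) A20; rewrite -/c1.
have /fineK := expected_capped_fin T0 l P N0 (Num.max M A) MA0; rewrite -/c2.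
move: (fine _) (fine _) => x2 x1 <- <-.
rewrite -!EFinD -leeBrDr// => /le_trans; apply.
by rewrite -EFinB lee_fin; lra.
Qed.

(** * Test functionals on the path space *)

Section test_functional.
Context {R : realType} {d : nat} {T : R}.
Hypothesis T0 : 0 <= T.
Variable a : R.
Hypothesis a0 : 0 <= a.

(** Weak convergence only tests bounded functions. The pairing with [cutoff a] takes
    values in this interval along empirical paths, so that clipping it there costs
    nothing. *)
Definition clip (x : R) : R := Num.min (Num.max 0 x) (T * a).

Lemma clip_continuous : continuous clip.
Proof.
move=> x; have c1 : {for x, continuous (fun y : R => Num.max 0 y : R^o)}.
  exact: (@continuous_max R _ (fun=> 0) id x (cvg_cst _) cvg_id).
exact: (@continuous_min R _ _ (fun=> T * a) x c1 (cvg_cst _)).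
Qed.

Lemma clip_itv x : 0 <= clip x <= T * a.
Proof. by rewrite /clip ge_min lexx orbT le_min mulr_ge0// le_max lexx. Qed.

Lemma clip_id x : 0 <= x <= T * a -> clip x = x.
Proof. by move=> /andP[x0 xa]; rewrite /clip max_r// min_l. Qed.

Definition test_functional (p : Linfty d T) : R := clip (pairing (cutoff_path a T) p).

Lemma test_functional_continuous : continuous test_functional.
Proof.
move=> p.
exact: (@continuous_comp _ _ _ _ clip p (pairing_continuous _ p) (clip_continuous _)).
Qed.

Lemma test_functional_bounded : exists B : R, forall p, `|test_functional p| <= B.
Proof.
exists (T * a) => p; have /andP[h0 h1] := clip_itv (pairing (cutoff_path a T) p).
by rewrite ger0_norm.
Qed.

Lemma pairing_measurable (F : L1_C1 d T) :
  measurable_fun [set: borel_Linfty d T] (pairing F : borel_Linfty d T -> R).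
Proof.
apply: (measurability _ (RGenOpens.measurableE R)).
move=> _ [_ [x [y ->]] <-]; rewrite setTI; apply: sub_sigma_algebra.
by move/continuousP: (pairing_continuous F); apply; exact: interval_open.
Qed.

(** The laws of the real variables [pairing (cutoff_path a T)] under [Q] and of the
    occupation integral under [P] agree, whence the change of variables on the
    real line instead of the path space. *)
Lemma test_functional_law {N l : nat} (N0 : (0 < N)%N)
    (P : probability (pathD d N T) R) (Q : probability (borel_Linfty d T) R) :
  (forall A, measurable A -> Q A = pushforward P (young_process l) A) ->
  \int[Q]_(p in setT) test_functional p =
  fine (expected_occupation P (capped_density l a)).
Proof.
move=> QP; rewrite /Rintegral; congr fine.
pose X : borel_Linfty d T -> R := pairing (cutoff_path a T).
pose Y (w : pathD d N T) : R := fine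
  (\int[lebesgue_measure]_(t in `[0%R, T]) (capped_density l a (w t))%:E)%E.
have f0 (z : config d N) : 0 <= capped_density l a z :> R := capped_density_ge0 l a z a0.
have mX : measurable_fun setT X := pairing_measurable _.
have mY : measurable_fun setT Y.
  apply: measurableT_comp => //; exact: occupation_measurable.
have XY w : X (young_process l w) = Y w by exact: pairing_young.
pose psi x : \bar R := (clip x)%:E.
have mpsi : measurable_fun setT psi.
  apply/measurable_EFinP; apply: continuous_measurable_fun; exact: clip_continuous.
have psi0 : {in setT, forall y, (0 <= psi y)%E}.
  by move=> x _; rewrite lee_fin; case/andP: (clip_itv x).
transitivity (\int[Q]_(p in X @^-1` setT) (psi \o X) p)%E.
  by rewrite preimage_setT.
rewrite -ge0_integral_pushforward//.
transitivity (\int[pushforward P Y]_y psi y)%E.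
  apply: eq_measure_integral => A mA _.
  transitivity (pushforward P (young_process l) (X @^-1` A)).
    by apply: QP; rewrite -[_ @^-1` _]setTI; exact: mX.
  by rewrite /pushforward; congr (P _); apply/seteqP; split=> w /=; rewrite XY.
rewrite ge0_integral_pushforward// preimage_setT.
apply: eq_integral => w _; rewrite /psi/=.
have o0 := occupation_ge0 (T := T) _ w f0.
have oa : (\int[lebesgue_measure]_(t in `[0%R, T]) (capped_density l a (w t))%:E
    <= (T * a)%:E)%E.
  rewrite -(occupation_cst T0 a); apply: occupation_le => // z.
  exact: capped_density_le_cap.
have ofin : (\int[lebesgue_measure]_(t in `[0%R, T]) (capped_density l a (w t))%:E)%E \is a fin_num.
  by rewrite ge0_fin_numE// (le_lt_trans oa)// ltry.
by rewrite clip_id ?fineK// fine_ge0//= -lee_fin fineK.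
Qed.

End test_functional.

(** * Upper limits *)

Lemma limn_esup_le_lim {R : realType} (u : (\bar R)^nat) (v : R^nat) (c : R) :
  (forall n, (u n <= (v n)%:E)%E) -> v n @[n --> \oo] --> c ->
  (limn_esup u <= c%:E)%E.
Proof.
move=> uv vc.
have vcE : (v n)%:E @[n --> \oo] --> c%:E by apply: cvg_EFin => //; exact: nearW.
have := cvg_esups vcE; rewrite limn_esup_lim => cv.
rewrite -(cvg_lim (@ereal_hausdorff R) cv).
apply: lee_lim; [exact: is_cvg_esups|by apply/cvg_ex; exists c%:E|].
apply: nearW => n; apply: ge_ereal_sup => _ [k nk <-].
by rewrite (le_trans (uv k))//; apply: ereal_sup_ubound; exists k.
Qed.

Lemma limn_esup_ge0 {R : realType} (u : (\bar R)^nat) :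
  (forall n, (0 <= u n)%E) -> (0 <= limn_esup u)%E.
Proof.
move=> u0; rewrite limn_esup_lim; apply: lime_ge; first exact: is_cvg_esups.
by apply: nearW => n; rewrite (le_trans (u0 n))//; apply: ereal_sup_ubound; exists n => /=.
Qed.

(** * Uniform integrability *)

Theorem lemma5p8 (R : realType) (d : nat) (hd : (0 < d)%N) (T : R) (hT : 0 < T)
  (g : nat -> R) (hg : jump_rate g)
  (mu0 : forall N : nat, probability (config d N) R)
  (hmoment : forall N, (0 < N)%N -> finite_first_moment (mu0 N))
  (mass : R) (hmass0 : 0 < mass) (hmass : mass_in_probability mu0 mass)
  (P : forall N : nat, probability (pathD d N T) R)
  (hP : forall N, (0 < N)%N -> is_zrp g (mu0 N) (P N))
  (m : nat -> nat) (hm : m l @[l --> \oo] --> \oo)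
  (k : nat -> nat -> nat) (hk0 : forall l N, (0 < k l N)%N)
  (hk : forall l, k l N @[N --> \oo] --> \oo)
  (Q : nat -> nat -> probability (borel_Linfty d T) R)
  (hQ : forall l N A, measurable A ->
    Q l N A = pushforward (P (k l N)) (young_process (m l)) A)
  (Qinf : nat -> probability (borel_Linfty d T) R)
  (Qstar : probability (borel_Linfty d T) R)
  (hQinf : forall l, weak_cvg (Q l) (Qinf l))
  (hQstar : weak_cvg Qinf Qstar)
  (hY1 : {ae Qstar, forall p, Linfty_Y1 p}) :
  ereal_sup
    [set limn_esup (fun l => limn_esup (fun N =>
       \int[P (k l N)]_w \int[lebesgue_measure]_(t in `[0%R, T])
         (truncated_excess (m l) A M (w t))%:E)%E)
    | M in [set M : R | 0 < M]]
  @[A --> +oo%R] --> 0%E.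
Proof.
have T0 : 0 <= T := ltW hT.
have g0 : g 0%N = 0 by case: hg => _ /(_ 0%N)[_ ->].
pose ex l N f := expected_occupation (P (k l N)) f.
pose e l N a : R := fine (ex l N (capped_density (m l) a)).
pose u_ l a : R := \int[Qinf l]_(p in setT) test_functional a p.
pose u a : R := \int[Qstar]_(p in setT) test_functional a p.
(* [u a] is the iterated limit of the expected capped densities [e l N a] *)
have e_cvg l a : 0 <= a -> e l N a @[N --> \oo] --> u_ l a.
  move=> a0.
  have := hQinf l _ (test_functional_continuous a) (test_functional_bounded T0 _ a0).
  by under eq_fun do rewrite (test_functional_law T0 _ a0 (hk0 _ _) _ _ (hQ _ _)).
have u_cvg a : 0 <= a -> u_ l a @[l --> \oo] --> u a.
  by move=> a0; apply: hQstar;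
    [exact: test_functional_continuous|exact: test_functional_bounded].
have fin l N a : 0 <= a -> ex l N (capped_density (m l) a) \is a fin_num.
  exact: expected_capped_fin.
have u_homo a b : 0 <= a -> a <= b -> u a <= u b.
  move=> a0 ab; have b0 := le_trans a0 ab.
  apply: (ler_cvg_to (u_cvg a a0) (u_cvg b b0)); apply: nearW => l.
  apply: (ler_cvg_to (e_cvg l a a0) (e_cvg l b b0)); apply: nearW => N.
  rewrite fine_le ?fin//; apply: expected_occupation_le => // z.
    exact: capped_density_ge0.
  exact: capped_density_homo.
(* [u] is bounded uniformly in the cap: the mean mass may be unbounded in
   [N], but the mass concentrates and the cap disposes of the exceptional event *)
have u_le a : 0 <= a -> u a <= T * (mass + 1).
  move=> a0; apply: (cvgr_to_le (u_cvg a a0)); apply: nearW => l.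
  pose bad N := fine (mu0 (k l N) [set eta | (1 <
    `|((k l N)%:R ^+ d)^-1 * (num_particles eta)%:R - mass|)%R]).
  have bad0 : bad N @[N --> \oo] --> 0.
    apply: fine_cvg; exact: (cvg_comp _ _ (hk l) (hmass 1 ltr01)).
  have : T * (mass + 1) + T * a * bad N @[N --> \oo] --> T * (mass + 1) + T * a * 0.
    by apply: cvgD; [exact: cvg_cst|apply: cvgM => //; exact: cvg_cst].
  rewrite mulr0 addr0 => lim_bad; apply: (ler_cvg_to (e_cvg l a a0) lim_bad).
  apply: nearW => N; rewrite -lee_fin /e fineK ?fin// EFinD [X in (_ + X)%E]EFinM /bad fineK ?fin_num_measure//.
  exact: (expected_occupation_mass T0 (m l) (hk0 l N) g0 (hP _ (hk0 l N)) _ _ (ltW hmass0) a0).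
pose S := sup [set u a | a in [set a | 0 <= a]].
have uS : has_sup [set u a | a in [set a | 0 <= a]].
  split; first by exists (u 0), 0 => /=.
  by exists (T * (mass + 1)) => _ [a a0 <-]; exact: u_le.
have u_leS a : 0 <= a -> u a <= S.
  by move=> a0; apply: (ub_le_sup uS.2); exists a.
have main_le (A M : R) : 0 < A -> 0 < M -> (limn_esup (fun l => limn_esup (fun N =>
    ex l N (truncated_excess (m l) A M))) <= (2 * (S - u (A / 2)))%:E)%E.
  move=> A0 M0; have A20 : 0 <= A / 2 by rewrite divr_ge0 ?(ltW A0).
  have MA0 : 0 <= Num.max M A by rewrite le_max (ltW M0).
  apply: (@le_trans _ _ (2 * (u (Num.max M A) - u (A / 2)))%:E); last first.
    by rewrite lee_fin ler_wpM2l// lerB// u_leS.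
  apply: (limn_esup_le_lim _ (fun l => 2 * (u_ l (Num.max M A) - u_ l (A / 2)))).
    move=> l.
    apply: (limn_esup_le_lim _ (fun N => 2 * (e l N (Num.max M A) - e l N (A / 2)))).
      by move=> N; exact: expected_excess_le.
    by apply: cvgM; [exact: cvg_cst|apply: cvgB; exact: e_cvg].
  by apply: cvgM; [exact: cvg_cst|apply: cvgB; exact: u_cvg].
(* [u] increases to [S], so the bound of [main_le], free of [M], tends to [0] *)
apply: (@squeeze_cvge _ _ _ _ (cst 0%E) _ (fun A => (2 * (S - u (A / 2)))%:E)).
- near=> A; have A0 : 0 < A by near: A; exact: nbhs_pinfty_gt.
  apply/andP; split; last first.
    by apply: ge_ereal_sup => _ [M M0 <-]; exact: main_le.
  apply: (@le_trans _ _ (limn_esup (fun l => limn_esup (fun N =>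
    ex l N (truncated_excess (m l) A 1))))).
    apply: limn_esup_ge0 => l; apply: limn_esup_ge0 => N.
    by apply: expected_occupation_ge0 => z; exact: truncated_excess_ge0.
  by apply: ereal_sup_ubound; exists 1 => /=.
- exact: cvg_cst.
apply: cvg_EFin; first exact: nearW.
apply/cvgrPdist_le => eps eps0.
have eps20 : 0 < eps / 2 by rewrite divr_gt0.
have [_ [a0 /= a00 <-] ua0] := sup_adherent eps20 uS.
near=> A.
have aA : a0 <= A / 2.
  by rewrite ler_pdivlMr//; near: A; exact: nbhs_pinfty_ge.
have A20 := le_trans a00 aA.
have h1 := u_leS _ A20; have h2 := u_homo _ _ a00 aA.
rewrite sub0r normrN ger0_norm; last by rewrite mulr_ge0// subr_ge0.
by move: ua0; rewrite -/S => ua0; lra.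
Unshelve. all: by end_near. Qed.
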